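(* Let $\mathbb{X},\mathbb{Y}$ be Euclidean spaces, let $g:\mathbb{X}\to\mathbb{R}\cup\{+\infty\}$ be closed, proper, convex, and let $\bar A\in\mathcal{L}(\mathbb{X},\mathbb{Y})$, $\bar b\in\mathbb{Y}$, $\bar\mu>0$ be fixed. Let $(\bar y,\bar t)\in\mathbb{Y}\times\mathbb{R}$ be a solution of the problem $$D'(\bar A,\bar b,\bar\mu,0):\qquad\min_{(y,t)\in\mathbb{Y}\times\mathbb{R}}\ \tfrac{\bar\mu}{2}\|y\|^2-\langle\bar b,y\rangle+t\quad\text{s.t.}\quad(\bar A^*y,t)\in\operatorname{epi} g^*.$$ Then the following are equivalent: (i) The partial constraint nondegeneracy holds at $(\bar y,\bar t)$ for $D'(\bar A,\bar b,\bar\mu,0)$, i.e. $$(\operatorname{rge}\bar A^*\times\mathbb{R})+\operatorname{lin}T_{\operatorname{epi} g^*}(\bar A^*\bar y,\bar t)=\mathbb{X}\times\mathbb{R}.$$ (ii) $\ker\bar A\cap\operatorname{par}\partial g^*(\bar A^*\bar y)=\{0\}$.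
   Context: A Euclidean space is a finite-dimensional real inner product space; $\mathcal{L}(\mathbb{X},\mathbb{Y})$ is the space of linear operators from $\mathbb{X}$ to $\mathbb{Y}$, $A^*$ is the adjoint, $\ker A$ the kernel and $\operatorname{rge}A$ the range of $A$. $g^*(z)=\sup_{x\in\mathbb{X}}\{\langle z,x\rangle-g(x)\}$ is the Fenchel conjugate of $g$, $\operatorname{epi} g^*=\{(z,t)\in\mathbb{X}\times\mathbb{R}: g^*(z)\le t\}$ is its epigraph, and $\partial$ denotes the convex subdifferential. For a convex set $\Omega$, the parallel subspace is defined, for any $x\in\Omega$, by $\operatorname{par}\Omega:=\operatorname{span}(\Omega-x)$. The tangent cone to a set $S$ at $\bar x\in S$ is $T_S(\bar x)=\{w:\exists\,t_k\downarrow0,\ w_k\to w,\ \bar x+t_kw_k\in S\}$; $\operatorname{lin}K$ denotes the lineality space of a convex cone $K$, i.e. the largest linear subspace contained in $K$. In general, for a constraint $G(u,p)\in\Theta$ with $\Theta\subset\mathbb{V}$ closed and convex, a point $\bar u$ feasible for the parameter $\bar p$ is called partially nondegenerate for $G$ with respect to $\Theta$ if $\operatorname{rge}\mathcal{J}_uG(\bar u,\bar p)+\operatorname{lin}T_\Theta(G(\bar u,\bar p))=\mathbb{V}$, where $\mathcal{J}_uG$ is the partial Jacobian in $u$. Here $u=(y,t)$, $p=(A,b,\mu,v)$, $\bar p=(\bar A,\bar b,\bar\mu,0)$, $G(u,p)=(A^*y+v,t)$, $\Theta=\operatorname{epi} g^*$, $\mathbb{V}=\mathbb{X}\times\mathbb{R}$,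 so $\mathcal{J}_uG(\bar u,\bar p)(w_1,w_2)=(\bar A^*w_1,w_2)$. *)

(* Defs.v *)
From HB Require Import structures.
From mathcomp Require Import all_boot all_order all_algebra sesquilinear ring.
From mathcomp Require Import all_classical all_reals all_analysis.

Set Implicit Arguments.
Unset Strict Implicit.
Unset Printing Implicit Defensive.

Import Order.TTheory GRing.Theory Num.Theory.
Import numFieldNormedType.Exports.

Local Open Scope classical_set_scope.
Local Open Scope ring_scope.

(* Norm and topology are the library's [normedModType] ones; the axiom below
   forces the norm to be the one induced by the inner product. The factory
   [Vector_isEuclidean] makes any [vectType] with an inner product an
   instance. *)
HB.mixin Record NormedVector_isEuclidean (R : realType) V
    & NormedModule R V & Vector R V := {
  inner : {dot V for (@idfun R)} ;
  normr_inner : forall x : V, `|x| = Num.sqrt (inner x x)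
}.

#[short(type="euclideanType")]
HB.structure Definition Euclidean (R : realType) :=
  {V of NormedVector_isEuclidean R V & NormedModule R V & Vector R V}.

Arguments inner {R s}.

Section dot_real.
Context {R : realType} {V : lmodType R} (f : {dot V for (@idfun R)}).

Lemma dot_sym x y : f x y = f y x.
Proof. by rewrite hermitian_subproof expr0 mul1r. Qed.

Lemma dotDl x y z : f (x + y) z = f x z + f y z.
Proof. exact: linearDl. Qed.

Lemma dotZl a x z : f (a *: x) z = a * f x z.
Proof. exact: linearZl_LR. Qed.

Lemma dotDr x y z : f z (x + y) = f z x + f z y.
Proof. by rewrite dot_sym dotDl !(dot_sym _ z). Qed.

Lemma dotZr a x z : f z (a *: x) = a * f z x.
Proof. by rewrite dot_sym dotZl (dot_sym x). Qed.

Lemma dot0l x : f 0 x = 0.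
Proof. by rewrite -(scale0r (0 : V)) dotZl mul0r. Qed.

Lemma dot_ge0 x : 0 <= f x x.
Proof.
by have [->|x0] := eqVneq x 0; [rewrite dot0l | exact/ltW/neq0_dnorm_gt0].
Qed.

Lemma dot_eq0 x : f x x = 0 -> x = 0.
Proof.
move=> fx0; apply/eqP; apply: contraT => /(neq0_dnorm_gt0 (s := f)).
by rewrite fx0 ltxx.
Qed.

Lemma dot_cauchy x y : f x y <= Num.sqrt (f x x) * Num.sqrt (f y y).
Proof.
set a := Num.sqrt (f x x); set b := Num.sqrt (f y y).
have aE : a ^+ 2 = f x x by rewrite sqr_sqrtr// dot_ge0.
have bE : b ^+ 2 = f y y by rewrite sqr_sqrtr// dot_ge0.
have [a0|a0] := eqVneq a 0.
  have -> : x = 0 by apply: dot_eq0; rewrite -aE a0 expr0n.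
  by rewrite dot0l mulr_ge0 ?sqrtr_ge0.
have [b0|b0] := eqVneq b 0.
  have -> : y = 0 by apply: dot_eq0; rewrite -bE b0 expr0n.
  by rewrite dot_sym dot0l mulr_ge0 ?sqrtr_ge0.
have ab0 : 0 < a * b by rewrite mulr_gt0// lt_neqAle sqrtr_ge0 eq_sym ?a0 ?b0.
have := dot_ge0 (b *: x + (- a) *: y).
rewrite !(dotDl, dotDr, dotZl, dotZr) -aE -bE (dot_sym y x).
rewrite (_ : _ + _ = (a * b) * ((a * b - f x y) *+ 2)); last first.
  by rewrite mulr2n !expr2; ring.
by rewrite pmulr_rge0// pmulrn_lge0// subr_ge0.
Qed.

End dot_real.

HB.factory Record Vector_isEuclidean (R : realType) V & Vector R V := {
  innerf : {dot V for (@idfun R)}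
}.

HB.builders Context R V & Vector_isEuclidean R V.

Let nrm (x : V) : R := Num.sqrt (innerf x x).

Let nrmD x y : nrm (x + y) <= nrm x + nrm y.
Proof.
rewrite -(@ler_pXn2r _ 2) ?nnegrE ?addr_ge0 ?sqrtr_ge0//.
rewrite sqr_sqrtr ?dot_ge0// sqrrD !sqr_sqrtr ?dot_ge0//.
rewrite !(dotDl, dotDr) (dot_sym innerf y x) addrA lerD2r -addrA lerD2l.
by rewrite -mulr2n ler_pMn2r// dot_cauchy.
Qed.

Let nrmZ (l : R) x : nrm (l *: x) = `|l| * nrm x.
Proof.
by rewrite /nrm dotZl dotZr mulrA -expr2 sqrtrM ?sqr_ge0// sqrtr_sqr.
Qed.

Let nrm0 x : nrm x = 0 -> x = 0.
Proof.
move/eqP; rewrite sqrtr_eq0 => fx.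
by apply: (@dot_eq0 _ _ innerf); apply/eqP; rewrite eq_le fx dot_ge0.
Qed.

HB.instance Definition _ := Lmodule_isNormed.Build R V nrmD nrmZ nrm0.
HB.instance Definition _ :=
  NormedVector_isEuclidean.Build R V (fun x => erefl (nrm x)).

HB.end.

Section riesz.
Context {R : realType} {X : euclideanType R}.

Let inner_linear (v : X) : linear (inner v : X -> R^o).
Proof. by move=> a x y; rewrite dotDr dotZr. Qed.

Let innerl (v : X) : {linear X -> R^o} :=
  HB.pack (inner v : X -> R^o)
    (GRing.isLinear.Build R X R^o *:%R _ (inner_linear v)).

Let riesz_fun (v : X) : 'Hom(X, R^o) := linfun (innerl v).

Let riesz_funE v x : riesz_fun v x = inner v x.
Proof. by rewrite /riesz_fun lfunE. Qed.

Let riesz_linear : linear riesz_fun.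
Proof.
by move=> a v w; apply/lfunP => x; rewrite add_lfunE scale_lfunE !riesz_funE
  dotDl dotZl.
Qed.

Let rieszl : {linear X -> 'Hom(X, R^o)} :=
  HB.pack riesz_fun (GRing.isLinear.Build R X 'Hom(X, R^o) *:%R _ riesz_linear).

Lemma riesz (phi : 'Hom(X, R^o)) : exists v, forall x, phi x = inner v x.
Proof.
pose J := linfun rieszl.
have kJ : lker J == 0%VS.
  apply/lker0P => v w; rewrite !lfunE/= => vw.
  apply/eqP; rewrite -subr_eq0; apply/eqP; apply: (@dot_eq0 _ _ inner).
  rewrite dotDl -scaleN1r dotZl mulN1r -!riesz_funE.
  by rewrite vw subrr.
have : phi \in limg J.
  suff -> : limg J = fullv by exact: memvf.
  apply/eqP; rewrite -dimv_leqif_eq ?subvf// limg_dim_eq; last first.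
    by rewrite (eqP kJ) capv0.
  by rewrite !dimvf; apply/eqP/esym/muln1.
by case/memv_imgP => v _ ->; exists v => x; rewrite lfunE/= riesz_funE.
Qed.

End riesz.

Section adjoint.
Context {R : realType} {X Y : euclideanType R}.
Implicit Types (A : 'Hom(X, Y)) (B : 'Hom(Y, X)).

Definition is_adjoint A B := forall x y, inner (A x) y = inner x (B y).

Definition adjoint A : 'Hom(Y, X) := xget 0 [set B | is_adjoint A B].

Lemma innerI (u v : X) : (forall x, inner x u = inner x v) -> u = v.
Proof.
move=> uv; apply/eqP; rewrite -subr_eq0; apply/eqP.
apply: (@dot_eq0 _ _ inner); rewrite -[in X in inner _ X]scaleN1r dotDr dotZr.
by rewrite uv mulN1r subrr.
Qed.

Lemma adjointP A : is_adjoint A (adjoint A).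
Proof.
rewrite /adjoint; case: xgetP => [B _ //|nadj].
have /choice[b bE] y : exists v, forall x, inner (A x) y = inner x v.
  have lin_y : linear (fun x => inner (A x) y : R^o).
    by move=> a u v; rewrite linearP dotDl dotZl.
  pose fy : {linear X -> R^o} := HB.pack (fun x => inner (A x) y : R^o)
    (GRing.isLinear.Build R X R^o *:%R _ lin_y).
  have [v vE] := riesz (linfun fy).
  by exists v => x; rewrite (dot_sym _ x) -vE lfunE.
have lin_b : linear b.
  by move=> a u v; apply: innerI => x; rewrite dotDr dotZr -!bE dotDr dotZr.
pose bl : {linear Y -> X} :=
  HB.pack b (GRing.isLinear.Build R Y X *:%R _ lin_b).
by have := nadj (linfun bl); case=> x y; rewrite lfunE bE.
Qed.

Lemma adjoint_unique A B : is_adjoint A B -> B = adjoint A.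
Proof.
move=> AB; apply/lfunP => y; apply: innerI => x.
by rewrite -AB (adjointP A).
Qed.

End adjoint.

Section convex_analysis.
Context {R : realType}.

Section functions.
Context {X : euclideanType R}.
Implicit Types (f : X -> \bar R) (x z : X).

Definition proper_efun f :=
  (forall x, f x != -oo%E) /\ (exists x, f x != +oo%E).

(* Only used together with [proper_efun], so the right-hand side never involves
   [-oo]. *)
Definition convex_efun f := forall (x y : X) (t : R), 0 < t -> t < 1 ->
  (f (t *: x + (1 - t) *: y)%R <= t%:E * f x + (1 - t)%:E * f y)%E.

Definition epi f : set (X * R) := [set p | (f p.1 <= p.2%:E)%E].

Definition closed_efun f := closed (epi f).

Definition conjugate f z : \bar R :=
  ereal_sup [set ((inner z x)%:E - f x)%E | x in [set: X]].

Definition subdiff f z : set X :=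
  [set v | f z \is a fin_num /\
    forall z', (f z + (inner v (z' - z)%R)%:E <= f z')%E].

End functions.

Section sets.

(* Linear span of an arbitrary, possibly infinite, set. *)
Definition lspan {V : vectType R} (S : set V) : set V :=
  [set v | exists2 s : seq V, [set` s] `<=` S & v \in span s].

(* For nonempty convex [Omega] this does not depend on the base point; the
   empty set has no base point, and [par set0] is empty, not [set 0]. *)
Definition par {V : vectType R} (Omega : set V) : set V :=
  [set v | exists2 x, Omega x & lspan [set y - x | y in Omega] v].

(* Union of the linear subspaces contained in [K]; when [K] is a convex cone
   this is the largest of them. *)
Definition lineality {V : vectType R} (K : set V) : set V :=
  [set v | exists2 U : {vspace V}, [set` U] `<=` K & v \in U].

Definition tangent_cone {V : normedModType R} (S : set V) (x : V) : set V :=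
  [set w | exists (t : R^nat) (w_ : V^nat),
    [/\ (forall k, 0 < t k), t @ \oo --> (0 : R), w_ @ \oo --> w &
        forall k, S (x + t k *: w_ k)]].

End sets.

End convex_analysis.

Section dual_problem.
Context {R : realType} {X Y : euclideanType R}.
Variables (g : X -> \bar R) (A : 'Hom(X, Y)) (b : Y) (mu : R).

Definition dual_feasible : set (Y * R) :=
  [set u | epi (conjugate g) (adjoint A u.1, u.2)].

Definition dual_obj (u : Y * R) : R :=
  mu / 2 * `|u.1| ^+ 2 - inner b u.1 + u.2.

Definition dual_solution (u : Y * R) :=
  dual_feasible u /\ forall u', dual_feasible u' -> dual_obj u <= dual_obj u'.

End dual_problem.

Section nondegeneracy.
Context {R : realType} {X Y : euclideanType R}.

(* rge (Jacobian in u of G) + lin T_Theta (G u) = V, where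
   G (y, t) = (A^* y, t), Theta = epi g^* and V = X * R. *)
Definition partial_nondegenerate (g : X -> \bar R) (A : 'Hom(X, Y))
    (u : Y * R) :=
  [set p + q | p in [set` limg (adjoint A)] `*` [set: R]
             & q in lineality
                      (tangent_cone (epi (conjugate g)) (adjoint A u.1, u.2))]
  = [set: X * R].

End nondegeneracy.

(* Main.v *)
Require Import Defs.
From HB Require Import structures.
From mathcomp Require Import all_boot all_order all_algebra.
From mathcomp Require Import all_classical all_reals all_analysis.
From mathcomp Require Import lra ring.

Set Implicit Arguments.
Unset Strict Implicit.
Unset Printing Implicit Defensive.

Import Order.TTheory GRing.Theory Num.Theory.
Import numFieldNormedType.Exports.
Local Open Scope classical_set_scope.
Local Open Scope ring_scope.

(* Write h for g^*, z for A^* y, and K for the cone of feasible directions of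
   epi h at (z, t), where t = h z by optimality. If v0 is a subgradient of h at
   z, separation shows that the tangent cone T = cl K consists of the (w, r)
   with <v, w> <= r for all subgradients v, so lin T consists of those with
   equality throughout, and the projection of lin T to X is the orthogonal of
   par (subdiff h z) =: P. Nondegeneracy then says rge A^* + P^perp = X, that
   is, ker A meets P only at 0.
   The subdifferential is nonempty in both cases: (ii) provides a point of P,
   and under (i) the dense cone rge A^* + pr_X K is all of X, so that the
   optimality of (y, t) has a Lagrange multiplier, which is a subgradient. *)

Definition convex_cone {R : realType} {V : lmodType R} (K : set V) :=
  [/\ K 0, forall a x, 0 <= a -> K x -> K (a *: x)
    & forall x y, K x -> K y -> K (x + y)].

Lemma convex_cone_sum {R : realType} {V : lmodType R} (K : set V) (I : Type)
    (r : seq I) (P : pred I) (F : I -> V) :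
  convex_cone K -> (forall i, P i -> K (F i)) -> K (\sum_(i <- r | P i) F i).
Proof. by move=> [K0 _ KD] KF; elim/big_ind : _. Qed.

(** * Finite-dimensional Hahn-Banach theorem for epigraph cones *)

Section hahn_banach.
Context {R : realType} {X : euclideanType R}.
Implicit Types (Q : set (X * R^o)).

(* [Q] plays the part of the epigraph of a sublinear functional that is finite
   everywhere. *)
Definition sublinear_epi Q :=
  [/\ convex_cone Q, forall x, exists s, Q (x, s)
    & forall s, Q (0, s) -> 0 <= s].

(** Adding the ray through [(- w, - a)] forces every linear minorant to be at least [a] at [w]. *)
Definition adjoin_ray Q (w : X) (a : R) : set (X * R^o) :=
  [set p | exists2 u, 0 <= u & Q (p.1 + u *: w, p.2 + u * a)].

Lemma sub_adjoin_ray Q w a : Q `<=` adjoin_ray Q w a.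
Proof. by move=> [x s] Qp; exists 0 => //=; rewrite scale0r mul0r !addr0. Qed.

Lemma adjoin_ray_opp Q w a : convex_cone Q -> adjoin_ray Q w a (- w, - a).
Proof. by move=> [Q0 _ _]; exists 1 => //=; rewrite scale1r mul1r !addNr. Qed.

(** A point [(0, s)] that uses the ray with weight [u > 0] rescales to [Q (w, s / u + a)], whence
    [0 <= s]. *)
Lemma adjoin_ray_sublinear Q w a : sublinear_epi Q ->
  (forall s, Q (w, s) -> a <= s) -> sublinear_epi (adjoin_ray Q w a).
Proof.
move=> [[Q0 QZ QD] Qdom Qge0] Qa; split; first split.
- exact: sub_adjoin_ray.
- move=> c [x s] c0 [u u0 /= /(QZ c _ c0) Qxs]; exists (c * u).
    exact: mulr_ge0.
  suff <- : c *: (x + u *: w, s + u * a) =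
    ((c *: x) + (c * u) *: w, c * s + c * u * a) :> X * R^o by [].
  by congr pair; [rewrite scalerDr scalerA | rewrite /GRing.scale/=; ring].
- move=> [x s] [y r] [u u0 Qx] [v v0 Qy]; exists (u + v); first exact: addr_ge0.
  move: (QD _ _ Qx Qy); congr (Q (_, _)) => /=; last by ring.
  by rewrite scalerDl addrACA.
- by move=> x; have [s Qs] := Qdom x; exists s; exact: sub_adjoin_ray.
- move=> s [u u0 /=]; rewrite add0r.
  move: u0; rewrite le_eqVlt => /predU1P[<-|u0].
    by rewrite scale0r mul0r addr0; exact: Qge0.
  have ui0 : 0 <= u^-1 by rewrite invr_ge0 ltW.
  move=> /(QZ _ _ ui0) Qs; have /Qa : Q (w, u^-1 * (s + u * a)).
    by move: Qs; congr (Q (_, _)); rewrite /= scalerA mulVf ?gt_eqF// scale1r.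
  by rewrite mulrDr mulrA mulVf ?gt_eqF// mul1r lerDr pmulr_rge0 ?invr_gt0.
Qed.

(** For a sublinear functional: it is linear on the line through [w], with value [a] at [w]. *)
Definition tight Q (w : X) := exists a : R, Q (w, a) /\ Q (- w, - a).

Lemma exists_tight Q w : sublinear_epi Q ->
  exists Q', [/\ sublinear_epi Q', Q `<=` Q' & tight Q' w].
Proof.
move=> sQ; have [[Q0 QZ QD] Qdom Qge0] := sQ.
pose S : set R := [set s | Q (w, s)].
have S0 : S !=set0 by have [s Qs] := Qdom w; exists s.
have [s' Qs'] := Qdom (- w).
have lbS : has_lbound S.
  exists (- s') => s Ss; rewrite -subr_ge0 opprK; apply: Qge0.
  by rewrite -(subrr w); exact: (QD (w, s) (- w, s')).
set a := inf S.
have sQ1 : sublinear_epi (adjoin_ray Q w a).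
  by apply: adjoin_ray_sublinear => // s Qs; exact: ge_inf.
(* The infimum [a] need not be attained, so the ray through [(w, a)] is adjoined as well. *)
have sQ2 : sublinear_epi (adjoin_ray (adjoin_ray Q w a) (- w) (- a)).
  apply: adjoin_ray_sublinear => // s Q1s.
  have [[_ _ Q1D] _ Q1ge0] := sQ1.
  apply/ler_addgt0Pr => e e0.
  have [r Sr rae] := inf_adherent e0 (conj S0 lbS).
  suff : 0 <= s + r by rewrite -/a in rae; lra.
  apply: Q1ge0; rewrite -(addNr w).
  by apply: (Q1D (- w, s) (w, r)) => //; exact: sub_adjoin_ray.
exists (adjoin_ray (adjoin_ray Q w a) (- w) (- a)); split=> //.
  by move=> p Qp; apply/sub_adjoin_ray/sub_adjoin_ray.
exists a; split; last by exact/sub_adjoin_ray/adjoin_ray_opp.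
have [cQ1 _ _] := sQ1.
by have := adjoin_ray_opp (- w) (- a) cQ1; rewrite !opprK.
Qed.

Lemma exists_tight_seq Q (s : seq X) : sublinear_epi Q ->
  exists Q', [/\ sublinear_epi Q', Q `<=` Q' & forall w, w \in s -> tight Q' w].
Proof.
move=> sQ; elim: s => [|w s [Q1 [sQ1 QQ1 Q1t]]].
  by exists Q; split.
have [Q2 [sQ2 Q12 Q2w]] := exists_tight w sQ1.
exists Q2; split=> // [|v]; first exact: subset_trans Q12.
rewrite inE => /predU1P[-> //|/Q1t[a [Qa QNa]]].
by exists a; split; exact: Q12.
Qed.

Lemma tight_unique Q w a b : sublinear_epi Q ->
  Q (w, a) -> Q (- w, - a) -> Q (w, b) -> Q (- w, - b) -> a = b.
Proof.
move=> [[_ _ QD] _ Qge0] Qa QNa Qb QNb; apply/eqP; rewrite eq_le.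
by apply/andP; split; rewrite -subr_ge0; apply: Qge0; rewrite -(subrr w);
  [exact: (QD (w, b) (- w, - a)) | exact: (QD (w, a) (- w, - b))].
Qed.

Lemma tightZD Q w v a b c : convex_cone Q ->
  Q (w, a) -> Q (- w, - a) -> Q (v, b) -> Q (- v, - b) ->
  Q (c *: w + v, c * a + b).
Proof.
move=> [_ QZ QD] Qa QNa Qb QNb; apply: (QD (c *: w, c * a) (v, b)) => //.
have [c0|/ltW c0] := leP 0 c; first exact: (QZ c (w, a)).
rewrite -(opprK c) scaleNr -scalerN mulNr -mulrN.
by apply: (QZ (- c) (- w, - a)) => //; rewrite oppr_ge0.
Qed.

Lemma tightN Q w v a b c : convex_cone Q ->
  Q (w, a) -> Q (- w, - a) -> Q (v, b) -> Q (- v, - b) ->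
  Q (- (c *: w + v), - (c * a + b)).
Proof.
move=> cQ Qa QNa Qb QNb; rewrite !opprD -scalerN -mulrN.
by apply: tightZD; rewrite ?opprK.
Qed.

(** Once enlarged to be tight on a basis, the cone is tight everywhere; its values, unique by
    [tight_unique], are linear, and [riesz] represents them. *)
Theorem sublinear_minorant Q : sublinear_epi Q ->
  exists v, forall x s, Q (x, s) -> inner v x <= s.
Proof.
move=> sQ.
have [Q' [sQ' QQ' Qt]] := exists_tight_seq (vbasis {:X}) sQ.
have cQ' : convex_cone Q' by case: sQ'.
have /choice[f fP] x : tight Q' x.
  rewrite (coord_vbasis (memvf x)); elim/big_ind : _ => [|u v|i _].
  - by exists 0; rewrite !oppr0; case: cQ'.
  - move=> [a [ua uNa]] [b [vb vNb]]; exists (1 * a + b).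
    by rewrite -[u]scale1r; split; [exact: tightZD | exact: tightN].
  - have [|a [Qa QNa]] := Qt (vbasis {:X})`_i.
      by rewrite mem_nth// size_tuple.
    set c := coord _ _ _; exists (c * a + 0).
    have [Q0 _ _] := cQ'.
    rewrite -[_ *: _]addr0.
    by split; [apply: tightZD | apply: tightN]; rewrite ?oppr0.
have flin : linear (f : X -> R^o).
  move=> c u v; have [[ua uNa] [vb vNb]] := (fP u, fP v).
  have [w1 w2] := fP (c *: u + v).
  by apply: (tight_unique sQ' w1 w2); [exact: tightZD | exact: tightN].
pose fl : {linear X -> R^o} :=
  HB.pack (f : X -> R^o) (GRing.isLinear.Build R X R^o *:%R _ flin).
have [v vE] := riesz (linfun fl).
exists v => x s /QQ' Qxs; rewrite -vE lfunE/= -subr_ge0.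
have [[_ _ QD] _ Qge0] := sQ'; apply: Qge0; rewrite -(subrr x).
by apply: (QD (x, s) (- x, - f x)) => //; case: (fP x).
Qed.

Corollary sublinear_minorant_at Q w a : sublinear_epi Q ->
  (forall s, Q (w, s) -> a <= s) ->
  exists2 v, (forall x s, Q (x, s) -> inner v x <= s) & a <= inner v w.
Proof.
move=> sQ Qa; have [v vQ] := sublinear_minorant (adjoin_ray_sublinear sQ Qa).
exists v => [x s Qxs|]; first by apply: vQ; exact: sub_adjoin_ray.
have := vQ _ _ (adjoin_ray_opp w a (let: And3 cQ _ _ := sQ in cQ)).
by rewrite -scaleN1r dotZr mulN1r lerN2.
Qed.

End hahn_banach.

Section inner_norm.
Context {R : realType} {X : euclideanType R}.

Lemma inner_self (x : X) : inner x x = `|x| ^+ 2.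
Proof. by rewrite normr_inner sqr_sqrtr// dot_ge0. Qed.

Lemma inner_le_normM (x y : X) : inner x y <= `|x| * `|y|.
Proof. by rewrite !normr_inner dot_cauchy. Qed.

End inner_norm.

(** A sequence in [S] whose span has the largest dimension works: a further vector of [S] cannot
    enlarge that span. *)
Lemma exists_spanning_seq {R : realType} {V : vectType R} (S : set V) :
  exists s : seq V, [set` s] `<=` S /\ forall v, S v -> v \in span s.
Proof.
pose P n := `[< exists s : seq V, [set` s] `<=` S /\ \dim (span s) = n >].
have P0 : exists n, P n.
  by exists (\dim (span ([::] : seq V))); apply/asboolP; exists [::]; split.
have Pub n : P n -> (n <= \dim {:V})%N.
  by move=> /asboolP[s [_ <-]]; exact/dimvS/subvf.
case: (ex_maxnP P0 Pub) => n /asboolP[s [sS <-]] smax.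
exists s; split=> // v Sv.
have /smax : P (\dim (span (v :: s))).
  apply/asboolP; exists (v :: s); split=> // x /=.
  by rewrite inE => /predU1P[->//|/sS].
rewrite span_cons => vs.
have /eqP -> : span s == (<[v]> + span s)%VS
  by rewrite -dimv_leqif_eq ?addvSr// eqn_leq dimvS ?addvSr.
exact/(subvP (addvSl _ _))/memv_line.
Qed.

(** * Dense convex cones are the whole space *)

Section dense_cone.
Context {R : realType} {X : euclideanType R}.
Implicit Types K : set X.

Definition approximable (V : normedModType R) (K : set V) (x : V) :=
  forall e, 0 < e -> exists2 k, K k & `|x - k| < e.

(** If [v] were nonzero, some [k] in [K] with [|v - k| < |v|] would give
    [<v, v> <= <v, v - k> < |v|^2]. *)
Lemma dense_polar0 K v : (forall x, approximable K x) ->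
  (forall k, K k -> inner v k <= 0) -> v = 0.
Proof.
move=> Kdense vK; apply/eqP/negPn/negP => v0.
have nv0 : 0 < `|v| by rewrite normr_gt0.
have [k Kk vk] := Kdense v _ nv0.
have : inner v v <= inner v (v - k).
  by rewrite dotDr -scaleN1r dotZr mulN1r lerDl oppr_ge0 vK.
rewrite inner_self => /le_trans/(_ (inner_le_normM _ _)).
by rewrite expr2 ler_pM2l// leNgt vk.
Qed.

(** The projection [projv U] need not be orthogonal, hence the adjoint: as [f] vanishes on [U],
    [adjoint f (f w)] is orthogonal to [K], so it is 0 and [f w = 0]. *)
Lemma dense_span K (U : {vspace X}) : (forall x, approximable K x) ->
  (forall k, K k -> k \in U) -> U = fullv.
Proof.
move=> Kdense KU; apply/vspaceP => w; rewrite memvf.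
pose f : 'End(X) := (\1 - projv U)%VF.
have fE x : f x = x - projv U x by rewrite /f add_lfunE opp_lfunE id_lfunE.
have v0 : adjoint f (f w) = 0.
  apply: (dense_polar0 Kdense) => k Kk.
  rewrite dot_sym -adjointP fE projv_id ?KU// subrr dot0l.
  exact: lexx.
have /(@dot_eq0 _ _ inner)/eqP : inner (f w) (f w) = 0.
  by rewrite adjointP v0 dot_sym dot0l.
by rewrite fE subr_eq0 => /eqP ->; exact: memv_proj.
Qed.

(* The cone contains the sum [e] of a spanning family, an interior point; if
   [- e] were outside of it, the gauge of the cone along [e] would yield a
   nonzero functional that is nonpositive on a dense set. *)
Lemma dense_convex_cone K : convex_cone K -> (forall x, approximable K x) ->
  forall x, K x.
Proof.
move=> cK Kdense; have [K0 KZ KD] := cK.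
have [s [sK Ks]] := exists_spanning_seq K.
have sT : span s = fullv by apply: (dense_span Kdense).
pose e := \sum_(i < size s) (in_tuple s)`_i.
have sKi (i : 'I_(size s)) : K (in_tuple s)`_i.
  by apply: sK => /=; exact: mem_nth.
(* Adding the sum of the absolute values of all coordinates makes each coordinate of [x]
   nonnegative. *)
have Ke x : exists2 a, 0 <= a & K (x + a *: e).
  have := memvf x; rewrite -sT => /(coord_span (X := in_tuple s)) xE.
  exists (\sum_(i < size s) `|coord (in_tuple s) i x|).
    by apply: sumr_ge0 => i _; exact: normr_ge0.
  rewrite {1}xE /e scaler_sumr -big_split/=.
  apply: convex_cone_sum => // i _; rewrite -scalerDl.
  apply: KZ; last exact: sKi.
  rewrite (bigD1 i)//= addrA addr_ge0//; last exact: sumr_ge0.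
  by rewrite -lerBlDl sub0r -normrN ler_norm.
have [KNe x|nKNe] := pselect (K (- e)).
  have [a a0 Ka] := Ke x.
  by rewrite -(addrK (a *: e) x) -scalerN; apply: KD => //; exact: KZ.
pose Q : set (X * R^o) := [set p | K (p.1 + p.2 *: e)].
have Qge r : 0 < r -> ~ K (- (r *: e)).
  move=> r0 /(KZ r^-1); rewrite invr_ge0 ltW// scalerN scalerA mulVf ?gt_eqF//.
  by rewrite scale1r => /(_ isT).
have sQ : sublinear_epi Q.
  split; first split.
  - by rewrite /Q/= scale0r addr0.
  - move=> a [x r] a0 /= /(KZ a _ a0); rewrite /Q/= scalerDr scalerA.
    by [].
  - move=> [x r] [y t] /= Qx Qy; have := KD _ _ Qx Qy.
    by rewrite /Q/= addrACA -scalerDl.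
  - by move=> x; have [a _ Ka] := Ke x; exists a.
  - move=> r; rewrite /Q/= add0r => Kr; rewrite leNgt; apply/negP => r0.
    by apply: (Qge (- r)); rewrite ?oppr_gt0// scaleNr opprK.
(* [Q (- e, r)] puts [(r - 1) *: e] in [K], so [1 <= r]. The resulting [v] is nonpositive on [K],
   hence 0, against [1 <= <v, - e>]. *)
have [r|v vQ] := @sublinear_minorant_at _ _ Q (- e) 1 sQ.
  rewrite /Q/= -scaleN1r -scalerDl => Kr; rewrite leNgt; apply/negP => r1.
  by apply: (Qge (1 - r)); rewrite ?subr_gt0// -scaleNr opprB addrC.
rewrite (_ : v = 0) ?dot0l ?ler10//.
by apply: (dense_polar0 Kdense) => k Kk; apply: vQ; rewrite /Q/= scale0r addr0.
Qed.

End dense_cone.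

(** * Feasible directions and tangent cones of convex sets *)

Section feasible_directions.
Context {R : realType}.

Definition convex_subset {V : lmodType R} (S : set V) := forall x y a,
  S x -> S y -> 0 <= a -> a <= 1 -> S (a *: x + (1 - a) *: y).

Definition feasible_dirs {V : lmodType R} (S : set V) (x : V) : set V :=
  [set w | exists2 t, 0 < t & S (x + t *: w)].

Lemma convex_subset_shrink {V : lmodType R} (S : set V) x w t u :
  convex_subset S -> S x -> 0 < t -> S (x + t *: w) -> 0 <= u -> u <= t ->
  S (x + u *: w).
Proof.
move=> cS Sx t0 Sxt u0 ut.
have := cS _ _ (u / t) Sxt Sx (divr_ge0 u0 (ltW t0)).
rewrite ler_pdivrMr// mul1r => /(_ ut).
rewrite scalerDr addrAC scalerA divfK ?gt_eqF// -scalerDl.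
by rewrite addrCA subrr addr0 scale1r.
Qed.

Lemma convex_cone_feasible_dirs {V : lmodType R} (S : set V) x :
  convex_subset S -> S x -> convex_cone (feasible_dirs S x).
Proof.
move=> cS Sx; split.
- by exists 1; rewrite ?ltr01// scaler0 addr0.
- move=> a w; rewrite le_eqVlt => /predU1P[<- _|a0 [t t0 Sw]].
    by exists 1; rewrite ?ltr01// scale0r scaler0 addr0.
  exists (t / a); first exact: divr_gt0.
  by rewrite scalerA divfK ?gt_eqF.
- move=> w1 w2 [t1 t10 Sw1] [t2 t20 Sw2].
  pose t := Num.min t1 t2.
  have t0 : 0 < t by rewrite lt_min t10.
  have St1 : S (x + t *: w1).
    by apply: (convex_subset_shrink _ _ t10) => //;
      [exact: ltW | rewrite ge_min lexx].
  have St2 : S (x + t *: w2).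
    by apply: (convex_subset_shrink _ _ t20) => //;
      [exact: ltW | rewrite ge_min lexx orbT].
  exists (t / 2); first by rewrite divr_gt0.
  have h0 : 0 <= 2^-1 :> R by rewrite invr_ge0.
  have h1 : 2^-1 <= 1 :> R by rewrite invf_le1 ?ler1n.
  have := cS _ _ _ St1 St2 h0 h1.
  rewrite (_ : 1 - 2^-1 = 2^-1); last by lra.
  rewrite !scalerDr addrACA !scalerA -scalerDl (mulrC _ t) -mulr2n.
  by rewrite -(mulr_natr 2^-1) mulVf ?pnatr_eq0// scale1r.
Qed.

(** By convexity, steps along feasible directions can be shortened, so approximating directions
    admit step lengths tending to 0. *)
Lemma tangent_coneE {V : normedModType R} (S : set V) x w :
  convex_subset S -> S x ->
  tangent_cone S x w <-> approximable (feasible_dirs S x) w.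
Proof.
move=> cS Sx; split.
- move=> [t [u [t0 _ /cvgrPdist_lt uw Su]]] e e0.
  have [N _ /(_ N (leqnn N)) /= uwe] := uw e e0.
  by exists (u N) => //; exists (t N).
- move=> wS.
  have /choice[u uP] (k : nat) :
      exists u, feasible_dirs S x u /\ `|w - u| < k.+1%:R^-1.
    by have [|u Su wu] := wS k.+1%:R^-1; [rewrite invr_gt0 | exists u].
  have /choice[t tP] (k : nat) :
      exists t, [/\ 0 < t, t <= k.+1%:R^-1 & S (x + t *: u k)].
    have [[t t0 St] _] := uP k.
    have m0 : 0 < Num.min t k.+1%:R^-1 by rewrite lt_min t0 invr_gt0 ltr0n.
    exists (Num.min t k.+1%:R^-1); split=> //.
      by rewrite ge_min lexx orbT.
    by apply: (convex_subset_shrink cS Sx t0 St);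
      [exact: ltW | rewrite ge_min lexx].
  exists t, u; split.
  + by move=> k; have [] := tP k.
  + apply: (@squeeze_cvgr _ _ _ _ (fun=> 0) (@harmonic R)).
    * by apply: nearW => k; have [/ltW -> /= tk _] := tP k.
    * exact: cvg_cst.
    * exact: cvg_harmonic.
  + apply/cvgrPdist_lt => e e0.
    have /cvgrPdist_lt/(_ e e0) := @cvg_harmonic R.
    apply: filterS => k /=; rewrite sub0r normrN ger0_norm//.
    by apply: lt_trans; have [] := uP k.
  + by move=> k; have [] := tP k.
Qed.

End feasible_directions.

(** * Subgradients and the tangent cone of an epigraph *)

Section tangent_epi.
Context {R : realType} {X : euclideanType R}.
Variables (h : X -> \bar R) (z : X) (t : R).
Hypotheses (hNy : forall x, h x != -oo%E) (hz : h z = t%:E).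
Hypothesis hconv : convex_subset (epi h : set (X * R^o)).

Let K : set (X * R^o) := feasible_dirs (epi h : set (X * R^o)) (z, t).

Let epi_z : epi h (z, t).
Proof. by rewrite /epi/= hz. Qed.

Let cK : convex_cone K.
Proof. exact: convex_cone_feasible_dirs. Qed.

(** The subgradient inequality at [z + a *: w] is divided by [a]; conversely, each point of the
    epigraph is reached by a feasible direction with step 1. *)
Lemma subdiff_feasibleP v :
  subdiff h z v <-> forall w r, K (w, r) -> inner v w <= r.
Proof.
split=> [[_ vh] w r [a a0]|vK].
  rewrite /epi/= => hw; have := le_trans (vh (z + a *: w)) hw.
  rewrite hz -EFinD lee_fin addrAC subrr add0r dotZr lerD2l.
  by rewrite /GRing.scale/= ler_pM2l.
split=> [|x]; first by rewrite hz.
move: (hNy x); case hx : (h x) => [s| |] // _; last by rewrite leey.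
rewrite hz -EFinD lee_fin -lerBrDl; apply: vK; exists 1 => //.
by rewrite /epi/= !scale1r !subrKC hx.
Qed.

Lemma feasible_dirs_epi_up w r s : K (w, r) -> r <= s -> K (w, s).
Proof.
move=> [a a0]; rewrite /epi/= => hw rs; exists a => //; apply: (le_trans hw).
by rewrite lee_fin lerD2l ler_pM2l.
Qed.

Lemma tangent_cone_subdiff_le v w r :
  tangent_cone (epi h) (z, t) (w, r) -> subdiff h z v -> inner v w <= r.
Proof.
move=> /(tangent_coneE _ hconv epi_z) Tw /subdiff_feasibleP vK.
apply/ler_addgt0Pr => e e0.
have M0 : 0 < `|v| + 1 by rewrite ltr_wpDl.
(* With this tolerance the two errors [|v| * |w - k|] and [s - r] add up to at most [e]. *)
have [|[k s] /vK vks] := Tw (e / (`|v| + 1)); first exact: divr_gt0.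
rewrite prod_normE/= gt_max => /andP[wk rs].
rewrite -(subrK k w) dotDr.
have h1 := inner_le_normM v (w - k).
have h2 : `|v| * `|w - k| <= `|v| * (e / (`|v| + 1)).
  by rewrite ler_wpM2l// ltW.
have h3 : s - r < e / (`|v| + 1).
  by rewrite (le_lt_trans _ rs)// distrC ler_norm.
have h4 : e = `|v| * (e / (`|v| + 1)) + e / (`|v| + 1).
  by field; rewrite gt_eqF.
by lra.
Qed.

(* Inf-convolving the directional derivative with [M `|.|] makes it finite
   everywhere, and for [M] large its value at [w] still exceeds [r] when
   [(w, r)] is not tangent. *)
Lemma subdiff_le_tangent_cone v0 w r : subdiff h z v0 ->
  (forall v, subdiff h z v -> inner v w <= r) ->
  tangent_cone (epi h) (z, t) (w, r).
Proof.
move=> sv0 wr; have /subdiff_feasibleP v0K := sv0.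
apply/(tangent_coneE _ hconv epi_z) => e e0; apply/not_exists2P => Kfar.
(* Heights can be raised to [max s r] within [K], so a direction [k] close to [w] can only miss [r]
   from above. *)
have {}Kfar k s : K (k, s) -> `|w - k| < e -> r + e <= s.
  move=> Kks wk; rewrite leNgt; apply/negP => sre.
  have Kkm : K (k, Num.max s r).
    by apply: (feasible_dirs_epi_up Kks); rewrite le_max lexx.
  have [//|] := Kfar (k, Num.max s r).
  apply; rewrite prod_normE/= gt_max wk/= distrC ger0_norm.
    by rewrite ltrBlDl gt_max sre ltrDl.
  by rewrite subr_ge0 le_max lexx orbT.
have v0w := wr _ sv0.
(* Chosen so that [(M - |v0|) * e = r + e - <v0, w>]: when [|w - k| >= e], the lower bound [v0] then
   gives [u + M * |w - k| >= r + e] for [K (k, u)]. *)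
pose M := `|v0| + (r + e - inner v0 w) / e.
have Me : `|v0| * e + (r + e - inner v0 w) = M * e.
  by rewrite /M; field; rewrite gt_eqF.
have v0M : `|v0| <= M by rewrite lerDl divr_ge0// ?ltW//; lra.
have M0 : 0 <= M := le_trans (normr_ge0 v0) v0M.
pose Q : set (X * R^o) :=
  [set p | exists k s, K (k, s) /\ s + M * `|p.1 - k| <= p.2].
have KQ k s : K (k, s) -> Q (k, s).
  by move=> Kk; exists k, s; rewrite subrr normr0 mulr0 addr0.
have [K0 KZ KD] := cK.
have v0le k s x : K (k, s) -> inner v0 x <= s + `|v0| * `|x - k|.
  move=> /v0K v0k; rewrite -{1}(subrKC k x) dotDr lerD//.
  exact: inner_le_normM.
have sQ : sublinear_epi Q.
  split; first split.
  - exact: KQ.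
  - move=> a [x s] a0 [k [u [Ku us]]]; exists (a *: k), (a * u).
    split; first exact: (KZ a (k, u)).
    rewrite /= -scalerBr normrZ ger0_norm// mulrCA -mulrDr.
    exact: ler_wpM2l.
  - move=> [x s] [y u] [k [c [Kc cs]]] [l [d [Kd du]]].
    exists (k + l), (c + d); split; first exact: (KD (k, c) (l, d)).
    apply: le_trans (lerD cs du); rewrite addrACA lerD2l -mulrDr ler_wpM2l//.
    by rewrite /= opprD addrACA ler_normD.
  - by move=> x; exists (M * `|x|); exists 0, 0; rewrite subr0 add0r.
  - move=> s [k [u [Ku /=]]]; apply: le_trans.
    apply: le_trans (_ : u + `|v0| * `|0 - k| <= _).
      by rewrite -(dot0l inner v0) dot_sym v0le.
    by rewrite lerD2l ler_wpM2r.
have [s|v vQ rev] := @sublinear_minorant_at _ _ Q w (r + e) sQ.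
  move=> [k [u [Ku /=]]]; apply: le_trans.
  have [wk|wk] := ltP `|w - k| e.
    by rewrite (le_trans (Kfar _ _ Ku wk))// lerDl mulr_ge0.
  have h1 := v0le k u w Ku.
  have h2 : (M - `|v0|) * e <= (M - `|v0|) * `|w - k|.
    by rewrite ler_wpM2l// subr_ge0.
  by rewrite !mulrBl in h2; lra.
have : inner v w <= r.
  by apply: wr; apply/subdiff_feasibleP => k s Ks; exact/vQ/KQ.
by move=> /(le_trans rev); rewrite gerDl leNgt e0.
Qed.

End tangent_epi.

(** * Epigraph of the conjugate *)

Section conjugate.
Context {R : realType} {X : euclideanType R}.
Variable g : X -> \bar R.
Hypothesis g_proper : proper_efun g.

(** Points where [g] is [+oo] contribute [-oo] to the supremum, so only the real values of [g]
    constrain [t]. *)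
Lemma epi_conjugateP z t : epi (conjugate g) (z, t) <->
  forall x r, g x = r%:E -> inner z x - r <= t.
Proof.
rewrite /epi/= /conjugate; split=> [gz x r gx|gz].
  rewrite -lee_fin; apply: le_trans gz; apply: ereal_sup_ubound.
  by exists x; rewrite // gx EFinB.
apply: ge_ereal_sup => _ [x _ <-]; have [gNy _] := g_proper.
move: (gNy x); case gx : (g x) => [r| |] // _; last by rewrite addeNy leNye.
by rewrite -EFinB lee_fin; exact: gz.
Qed.

(** The inequalities of [epi_conjugateP] are affine in [(z, t)] and survive convex combinations. *)
Lemma convex_epi_conjugate :
  convex_subset (epi (conjugate g) : set (X * R^o)).
Proof.
move=> [x s] [y u] a /epi_conjugateP xs /epi_conjugateP yu a0 a1.
apply/epi_conjugateP => w r gw; rewrite dotDl !dotZl /GRing.scale/=.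
have h1 : a * (inner x w - r) <= a * s by rewrite ler_wpM2l// xs.
have h2 : (1 - a) * (inner y w - r) <= (1 - a) * u.
  by rewrite ler_wpM2l ?subr_ge0// yu.
apply: le_trans (lerD h1 h2); rewrite le_eqVlt; apply/orP; left; apply/eqP.
by ring.
Qed.

Lemma conjugate_neqNy z : conjugate g z != -oo%E.
Proof.
have [gNy [x gx]] := g_proper; rewrite -ltNye.
have gfin : g x \is a fin_num by rewrite fin_numE gNy.
apply: (@lt_le_trans _ _ ((inner z x)%:E - g x)%E).
  by rewrite -(fineK gfin) -EFinB ltNye.
by apply: ereal_sup_ubound; exists x.
Qed.

End conjugate.

(** * Optimality conditions and existence of a multiplier *)

Section dual_solution.
Context {R : realType} {X Y : euclideanType R}.
Variables (g : X -> \bar R) (A : 'Hom(X, Y)) (b : Y) (mu : R) (y : Y) (t : R).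
Hypotheses (g_proper : proper_efun g) (mu_gt0 : 0 < mu).
Hypothesis sol : dual_solution g A b mu (y, t).

Let h := conjugate g.
Let K : set (X * R^o) := feasible_dirs (epi h : set (X * R^o)) (adjoint A y, t).

(** Were the constraint slack, lowering [t] would stay feasible and decrease the objective. *)
Lemma dual_solution_conjugate : h (adjoint A y) = t%:E.
Proof.
have [/= ht tmin] := sol; rewrite /dual_feasible /epi/= -/h in ht.
have := conjugate_neqNy g_proper (adjoint A y); rewrite -/h.
case hr : (h (adjoint A y)) ht => [r| |]//; rewrite lee_fin => rt _.
congr EFin; apply/eqP; rewrite eq_le rt/=.
have := tmin (y, r); rewrite /dual_obj/= lerD2l; apply.
by rewrite /dual_feasible /epi/= -/h hr.
Qed.

(** A small step [c] along [(w, r)] changes the objective by [c * (s + c * N)], with [s] the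
    asserted quantity and [N = mu / 2 * |w|^2]; optimality makes this nonnegative, and [c] tends to
    0. *)
Lemma dual_solution_first_order w r :
  K (adjoint A w, r) -> 0 <= mu * inner y w - inner b w + r.
Proof.
move=> Kwr; have [/= ht tmin] := sol.
have cE : convex_subset (epi h : set (X * R^o)) := convex_epi_conjugate g_proper.
have [a a0 hwr] := Kwr.
set s := mu * _ - _ + _.
pose N := mu / 2 * `|w| ^+ 2.
have N0 : 0 <= N by rewrite mulr_ge0 ?exprn_ge0// divr_ge0// ltW.
have ineq c : 0 < c -> c <= a -> 0 <= s + c * N.
  move=> c0 ca.
  have hcw := convex_subset_shrink cE ht a0 hwr (ltW c0) ca.
  have := tmin (y + c *: w, t + c * r).
  rewrite /dual_feasible/= linearD linearZ/= => /(_ hcw).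
  rewrite /dual_obj/= -!inner_self !(dotDl, dotDr, dotZl, dotZr) (dot_sym _ w y).
  rewrite -subr_ge0 => H; rewrite -(pmulr_rge0 _ c0); apply: le_trans H _.
  rewrite le_eqVlt; apply/orP; left; apply/eqP.
  by rewrite /s /N -inner_self; field.
apply/ler_addgt0Pr => e e0; pose c := Num.min a (e / (N + 1)).
have M0 : 0 < N + 1 by rewrite ltr_wpDl.
have c0 : 0 < c by rewrite lt_min a0 divr_gt0.
have ca : c <= a by rewrite ge_min lexx.
apply: le_trans (ineq c c0 ca) _; rewrite lerD2l.
have ce : c <= e / (N + 1) by rewrite ge_min lexx orbT.
rewrite ler_pdivlMr// in ce; apply: le_trans ce; rewrite ler_wpM2l ?ltW//.
by rewrite ltrDl.
Qed.

(* Nondegeneracy turns into Robinson's condition [rge A^* + pr_X K = X], under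
   which the optimality condition has a Lagrange multiplier. *)
Lemma nondegenerate_subdiff_nonempty : partial_nondegenerate g A (y, t) ->
  subdiff h (adjoint A y) !=set0.
Proof.
move=> nondeg; have [/= ht _] := sol.
have cE : convex_subset (epi h : set (X * R^o)) := convex_epi_conjugate g_proper.
have cK : convex_cone K by exact: convex_cone_feasible_dirs.
have [K0 KZ KD] := cK.
pose D : set X := [set x | exists w s, K (adjoint A w + x, s)].
have cD : convex_cone D.
  split.
  - by exists 0, 0; rewrite linear0 addr0.
  - move=> a x a0 [w [s Kws]]; exists (a *: w), (a * s).
    by rewrite linearZ -scalerDr; exact: (KZ a (_, s)).
  - move=> x1 x2 [w1 [s1 K1]] [w2 [s2 K2]]; exists (w1 + w2), (s1 + s2).
    by rewrite linearD addrACA; exact: (KD (_, s1) (_, s2)).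
(* Nondegeneracy writes [x] as [adjoint A w + q1] with [(q1, q2)] tangent, and feasible directions
   approximate tangent ones. *)
have DT : forall x, D x.
  apply: (dense_convex_cone cD) => x e e0.
  have : [set: X * R] (x, 0) by [].
  rewrite -nondeg => -[[p1 p2] [/= /memv_imgP[w _ p1E] _]] [[q1 q2]].
  move=> [U UT qU] [xE _].
  have /(tangent_coneE _ cE ht) Tq := UT _ qU.
  have [[k s] Kks] := Tq e e0; rewrite prod_normE/= gt_max => /andP[qk _].
  exists (p1 + k); last by rewrite -xE p1E opprD addrACA subrr add0r.
  by exists (- w), s; rewrite p1E linearN addKr.
pose c w := mu * inner y w - inner b w.
have c0 : c 0 = 0 by rewrite /c !(dot_sym _ _ 0) !dot0l mulr0 subrr.
have cD' u v : c (u + v) = c u + c v by rewrite /c !dotDr; ring.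
have cZ a v : c (a *: v) = a * c v by rewrite /c !dotZr; ring.
(* This cone encodes [x |-> inf_w (c w + h'(z; adjoint A w + x))], with [z = adjoint A y]. A linear
   minorant is a multiplier; taking [w = 0] shows that it is a subgradient. *)
pose Q : set (X * R^o) :=
  [set p | exists w, K (adjoint A w + p.1, p.2 - c w)].
have sQ : sublinear_epi Q.
  split; first split.
  - by exists 0; rewrite linear0 c0 subr0 addr0.
  - move=> a [x s] a0 [w Kw]; exists (a *: w).
    rewrite /= linearZ cZ -scalerDr /GRing.scale/= -mulrBr.
    exact: (KZ a (_, _)).
  - move=> [x1 s1] [x2 s2] [w1 K1] [w2 K2]; exists (w1 + w2).
    rewrite /= linearD cD' addrACA opprD (addrACA s1).
    exact: (KD (_, _) (_, _)).
  - by move=> x; have [w [s Ks]] := DT x; exists (s + c w), w; rewrite /= addrK.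
  - move=> s [w]; rewrite /= addr0 => /dual_solution_first_order.
    by rewrite -/(c w) addrC subrK.
have [v vQ] := sublinear_minorant sQ.
exists v.
apply/(subdiff_feasibleP (conjugate_neqNy g_proper) dual_solution_conjugate).
by move=> x s Ks; apply: vQ; exists 0; rewrite /= linear0 add0r c0 subr0.
Qed.

End dual_solution.

(** * Kernel-range duality and the equivalence *)

(** Injectivity of [A] on [P] provides a left inverse there, whose adjoint solves [adjoint A w = x]
    modulo the orthogonal of [P]. *)
Lemma adjoint_surj_mod_orth {R : realType} {X Y : euclideanType R}
    (A : 'Hom(X, Y)) (P : {vspace X}) (x : X) :
  (forall p, p \in P -> A p = 0 -> p = 0) ->
  exists w, forall p, p \in P -> inner p (adjoint A w) = inner p x.
Proof.
move=> Ainj; pose f := (A \o projv P)%VF.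
pose M : 'Hom(Y, X) := (projv P \o f^-1)%VF.
(* [M] is a left inverse of [A] on [P]. *)
exists (adjoint M x) => p Pp; rewrite -!adjointP; suff -> : M (A p) = p by [].
have fE u : f u = A (projv P u) by rewrite comp_lfunE.
have ApE : f (f^-1%VF (A p)) = A p.
  by apply: limg_lfunVK; rewrite -{1}(projv_id Pp) -fE memv_img ?memvf.
(* Both vectors lie in [P] and have the same image under [A]. *)
rewrite comp_lfunE; apply/eqP; rewrite -subr_eq0; apply/eqP; apply: Ainj.
  by rewrite memvB// memv_proj.
by rewrite linearB/= -fE ApE subrr.
Qed.

Theorem lemma3p2 (R : realType) (X Y : euclideanType R) (g : X -> \bar R)
    (A : 'Hom(X, Y)) (b : Y) (mu : R) (y : Y) (t : R)
    (g_proper : proper_efun g) (g_closed : closed_efun g) (g_convex : convex_efun g)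
    (mu_gt0 : 0 < mu) (sol : dual_solution g A b mu (y, t)) :
  partial_nondegenerate g A (y, t) <->
  [set` lker A] `&` par (subdiff (conjugate g) (adjoint A y)) = [set 0].
Proof.
have hz := dual_solution_conjugate g_proper sol.
have hNy := conjugate_neqNy g_proper.
have cE := convex_epi_conjugate g_proper.
set z := adjoint A y in hz *; set h := conjugate g in hz hNy cE *.
split=> [nondeg|kerpar].
- have [v0 sv0] := nondegenerate_subdiff_nonempty g_proper mu_gt0 sol nondeg.
  rewrite eqEsubset; split=> [x|_ ->]; last first.
    split; first exact: mem0v.
    by exists v0 => //; exists [::]; [| exact: mem0v].
  move=> [/= /[!memv_ker] /eqP Ax0 [v1 sv1 [s sS xs]]].
  have : [set: X * R] (x, 0) by [].
  rewrite -nondeg => -[[p1 p2] [/= /memv_imgP[w _ p1E] _]] [[q1 q2]].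
  move=> [U UT qU] [xE _].
  (* The subspace [U] also contains [(- q1, - q2)], so the tangent inequality holds with both
     signs. *)
  have qv v : subdiff h z v -> inner v q1 = q2.
    move=> sv; apply/eqP; rewrite eq_le; apply/andP; split.
      exact: (tangent_cone_subdiff_le hNy hz cE (UT _ qU) sv).
    have NqU : (- q1, - q2) \in U by rewrite -[X in X \in _]/(- (q1, q2)) memvN.
    have := tangent_cone_subdiff_le hNy hz cE (UT _ NqU) sv.
    by rewrite -scaleN1r dotZr mulN1r lerN2.
  have xq : inner x q1 = 0.
    rewrite (coord_span (X := in_tuple s) xs); elim/big_ind : _.
    + exact: dot0l.
    + by move=> u v u0 v0'; rewrite dotDl u0 v0' addr0.
    + move=> i _; rewrite dotZl.
      have /sS[v sv <-] : s`_i \in s by exact: mem_nth.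
      by rewrite dotDl -scaleN1r dotZl mulN1r !qv// subrr mulr0.
  (* Pairing [x] with [x = adjoint A w + q1] gives [<A x, w> + <x, q1> = 0]. *)
  apply: (@dot_eq0 _ _ inner).
  by rewrite -{2}xE dotDr xq addr0 p1E -adjointP Ax0 dot0l.
(* Membership of 0 in [par] comes with a base point, that is, a subgradient. *)
- have [_ [v0 sv0 _]] : ([set` lker A] `&` par (subdiff h z)) 0 by rewrite kerpar.
  have [s [sS Ss]] := exists_spanning_seq [set v - v0 | v in subdiff h z].
  apply/seteqP; split=> // -[x r] _.
  have [|w wP] := @adjoint_surj_mod_orth _ _ _ A (span s) x.
    move=> p ps Ap0; have : ([set` lker A] `&` par (subdiff h z)) p.
      by split; [rewrite /= memv_ker Ap0 | exists v0 => //; exists s].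
    by rewrite kerpar.
  (* As [q1] is orthogonal to all differences [v - v0], every subgradient takes the value [q2] at
     it. *)
  pose q1 := x - adjoint A w; pose q2 := inner v0 q1.
  have qv v : subdiff h z v -> inner v q1 = q2.
    move=> sv; rewrite -(subrK v0 v) dotDl /q2 -[RHS]add0r; congr (_ + _).
    have vs : v - v0 \in span s by apply: Ss; exists v.
    by rewrite /q1 dotDr -[- adjoint A w]scaleN1r dotZr mulN1r wP// subrr.
  exists (adjoint A w, r - q2); first by split=> //; exact/memv_img/memvf.
  exists (q1, q2); last by congr pair; [rewrite /q1 subrKC | rewrite /= subrK].
  (* Multiples of [(q1, q2)] of either sign satisfy the subgradient inequalities with equality, so
     the whole line is tangent. *)
  exists <[(q1, q2) : (X * R^o)%type]>%VS; last exact: memv_line.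
  move=> _ /= /vlineP[a ->].
  apply: (@subdiff_le_tangent_cone _ _ _ _ _ hNy hz cE v0 (a *: q1) (a * q2)).
    exact: sv0.
  move=> v sv.
  by rewrite dotZr qv.
Qed.
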